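(* (a) Every $\mathcal F\in\beta N\setminus MAX$ has an immediate successor in $(\beta N,\widetilde{\mid})$. (b) Every $\mathcal F\in\beta N$ for which there are $p\in P$ and $n\in N\setminus\{0\}$ such that $p^n\,\widetilde{\mid}\,\mathcal F$ and $p^{n+1}\,\widetilde{\nmid}\,\mathcal F$ has an immediate predecessor in $(\beta N,\widetilde{\mid})$.
   Context: $N=\{0,1,2,\dots\}$, $P$ the set of primes, $\beta N$ the set of ultrafilters on $N$, with $m\in N$ identified with the principal ultrafilter at $m$. For $A\subseteq N$, $A{\uparrow}=\{m\in N:\exists a\in A\ a\mid m\}$, $\mathcal U=\{A\subseteq N:A{\uparrow}=A\}$; $\mathcal F\,\widetilde{\mid}\,\mathcal G$ iff $\mathcal F\cap\mathcal U\subseteq\mathcal G$ (so $m\,\widetilde{\mid}\,\mathcal F$ iff $mN\in\mathcal F$); $\mathcal F=_\sim\mathcal G$ iff both $\mathcal F\,\widetilde{\mid}\,\mathcal G$ and $\mathcal G\,\widetilde{\mid}\,\mathcal F$. $MAX$ is the set of ultrafilters containing $\mathcal U$. $\mathcal G$ is an immediate successor of $\mathcal F$ (and $\mathcal F$ an immediate predecessor of $\mathcal G$) if $\mathcal F\,\widetilde{\mid}\,\mathcal G$, $\mathcal F\neq_\sim\mathcal G$, and there is no $\mathcal H$ with $\mathcal F\,\widetilde{\mid}\,\mathcal H\,\widetilde{\mid}\,\mathcal G$, $\mathcal F\neq_\sim\mathcal H\neq_\sim\mathcal G$.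
   Formalization: MAX is taken as the ultrafilters containing every nonempty set of 𝒰: literally ∅∈𝒰, so MAX would be empty and (a) would fail for the principal ultrafilter at 0, which has no successor; with 0∈N, MAX consists of that ultrafilter alone. *)

(* Defs.v *)
From mathcomp Require Import all_boot.
From mathcomp Require Import boolp classical_sets filter.

Set Implicit Arguments.
Unset Strict Implicit.
Unset Printing Implicit Defensive.

Local Open Scope classical_set_scope.

Record betaN := BetaN {
  betaN_sets :> set_system nat;
  betaN_ultra : UltraFilter betaN_sets
}.

#[global] Existing Instance betaN_ultra.

Definition principal (m : nat) : betaN := BetaN (principal_filter_ultra m).

Definition upclosure (A : set nat) : set nat :=
  [set m | exists2 a, A a & a %| m].

Definition calU : set_system nat := [set A | upclosure A = A].

Definition tdvd (F G : betaN) : Prop := F `&` calU `<=` G.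

Definition teq (F G : betaN) : Prop := tdvd F G /\ tdvd G F.

(* The empty set satisfies [calU] and lies in no ultrafilter, so it has to be
   left out here. Since [0 %| m] only for [m = 0], the set [[set 0]] is in
   [calU]. *)
Definition MAX : set betaN := [set F | calU `\ set0 `<=` F].

(* The second argument is the successor (resp. predecessor) of the first. *)
Definition immediate_succ (F G : betaN) : Prop :=
  [/\ tdvd F G, ~ teq F G &
      ~ exists H : betaN, [/\ tdvd F H, tdvd H G, ~ teq F H & ~ teq H G]].

Definition immediate_pred (F G : betaN) : Prop := immediate_succ G F.

Lemma principal_tdvdE (m : nat) (F : betaN) :
  tdvd (principal m) F <-> betaN_sets F [set k | m %| k].
Proof.
split=> [mF|FmN A [/principal_filterP Am UA]].
  apply: mF; split; first exact/principal_filterP/dvdnn.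
  apply/seteqP; split=> k /=; first by move=> [a ma ak]; apply: dvdn_trans ak.
  by move=> mk; exists k.
by apply: filterS FmN => k /= mk; rewrite -UA; exists m.
Qed.

(* Main.v *)
Require Import Defs.
From mathcomp Require Import all_boot.
From mathcomp Require Import boolp classical_sets filter.

(** If [p ^ k] exactly divides [F], the immediate successor of [F] is the image
    of [F] under multiplication by [p]: any [H] between the two is concentrated
    on the numbers of [p]-adic valuation [k] or [k + 1], and an up-set is
    determined on each of these levels by its trace on [F], respectively on
    [p F]. Dividing by [p] gives predecessors in the same way. If [F] is divisible
    by every positive integer but is not the principal ultrafilter at [0], then
    that ultrafilter is its immediate successor. *)

Set Implicit Arguments.
Unset Strict Implicit.

Local Open Scope classical_set_scope.

Lemma ultra_setC_filter (T : Type) (F : set_system T) :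
  ProperFilter F -> (forall A, F A \/ F (~` A)) -> UltraFilter F.
Proof.
move=> PF FAC; split=> // G PG FG; apply/seteqP; split=> // A GA.
have [//|/FG GnA] := FAC A.
by have [x []] := filter_ex (filterI GA GnA).
Qed.

Lemma fmap_ultra (T U : Type) (f : T -> U) (F : set_system T) :
  UltraFilter F -> UltraFilter (fmap f F).
Proof.
move=> UF; apply: ultra_setC_filter => A.
exact: (in_ultra_setVsetC (f @^-1` A) UF).
Qed.

Definition betaN_map (f : nat -> nat) (F : betaN) : betaN :=
  BetaN (@fmap_ultra _ _ f F (betaN_ultra F)).

Definition multiples (n : nat) : set nat := [set m | n %| m].

Lemma calUP (A : set nat) :
  calU A <-> (forall a m, A a -> a %| m -> A m).
Proof.
split=> [UA a m Aa am|UA]; first by rewrite -UA; exists a.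
apply/seteqP; split=> m; first by case=> a Aa; apply: UA.
by move=> Am; exists m.
Qed.

Lemma calU_upclosure (A : set nat) : calU (upclosure A).
Proof.
by apply/calUP => a m [b Ab ba] am; exists b => //; apply: dvdn_trans am.
Qed.

Lemma sub_upclosure (A : set nat) : A `<=` upclosure A.
Proof. by move=> a Aa; exists a. Qed.

Lemma calU_multiples (n : nat) : calU (multiples n).
Proof. by apply/calUP => a m /=; apply: dvdn_trans. Qed.

Lemma betaN_setC (F : betaN) (A : set nat) :
  ~ betaN_sets F A -> betaN_sets F (~` A).
Proof. by have [|] := in_ultra_setVsetC A (betaN_ultra F). Qed.

Lemma betaN_disjoint {F : betaN} {A B : set nat} :
  betaN_sets F A -> betaN_sets F B -> (forall m, A m -> ~ B m) -> False.
Proof. by move=> FA FB AB; have [m [/AB]] := filter_ex (filterI FA FB). Qed.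

Definition level (p k : nat) : set nat :=
  [set m | p ^ k %| m /\ ~ (p ^ k.+1 %| m)].

Lemma level_multiples (F : betaN) (p k : nat) :
  betaN_sets F (multiples (p ^ k)) -> ~ betaN_sets F (multiples (p ^ k.+1)) ->
  betaN_sets F (level p k).
Proof. by move=> Fk /betaN_setC Fk1; apply: filterI. Qed.

(** Write [a] as [b * p ^ k] with [p] not dividing [b]. Then [b] and [p ^ k.+1] are coprime divisors
    of [m], so their product [p * a] divides [m]. *)
Lemma level_dvdn (p k a m : nat) : prime p ->
  level p k a -> p ^ k.+1 %| m -> a %| m -> p * a %| m.
Proof.
move=> pp [/dvdnP[b ->] bk]; rewrite mulnCA -expnS => pm bm.
have pb : ~~ (p %| b).
  by apply/negP => pb; apply: bk; rewrite expnS dvdn_mul.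
rewrite Gauss_dvd ?pm ?andbT; first exact: dvdn_trans (dvdn_mulr _ _) bm.
by rewrite coprime_sym coprimeXl // prime_coprime.
Qed.

Lemma mulp_level (p k m : nat) : prime p ->
  level p k.+1 (p * m) <-> level p k m.
Proof. by move=> /prime_gt0 p0; rewrite /level /= !expnS !dvdn_pmul2l. Qed.

(** [G] is specified only through its members, so that the lemma serves both for multiplying [F] by
    [p] in (a) and for dividing by [p] in (b). *)
Lemma immediate_succ_mulp (F G : betaN) (p k : nat) : prime p ->
  betaN_sets F (level p k) ->
  (forall A, betaN_sets G A <-> betaN_sets F [set m | A (p * m)]) ->
  immediate_succ F G.
Proof.
move=> pp Fk GE.
have Gk : betaN_sets G (level p k.+1).
  by apply/GE; apply: filterS Fk => m /(mulp_level _ _ pp).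
have GpkS : betaN_sets G (multiples (p ^ k.+1)).
  by apply: filterS Gk => m [].
split.
- move=> A [FA /calUP UA]; apply/GE; apply: filterS FA => m /= Am.
  by apply: UA Am _; apply: dvdn_mull.
- case=> _ /(_ _ (conj GpkS (calU_multiples _))) FpkS.
  by apply: betaN_disjoint FpkS Fk _ => m pm [].
case=> H [FH HG nFH nHG].
have Hpk : betaN_sets H (multiples (p ^ k)).
  by apply: FH; split; [apply: filterS Fk => m []|exact: calU_multiples].
have [HpkS|nHpkS] := pselect (betaN_sets H (multiples (p ^ k.+1))).
  (* Here [H] is equivalent to [G]: a multiple of [p ^ k.+1] lying above some [m] in [B] is already
     a multiple of [p * m], which is in [A]. *)
  apply: nHG; split=> // A [/GE FA /calUP UA].
  pose B := level p k `&` [set m | A (p * m)].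
  have HB : betaN_sets H (upclosure B).
    apply: FH; split; last exact: calU_upclosure.
    exact: filterS (@sub_upclosure B) (filterI Fk FA).
  apply: filterS (filterI HB HpkS) => x [[m [mk Apm] mx] px].
  by apply: UA Apm _; apply: level_dvdn mk px mx.
have Hk := level_multiples Hpk nHpkS.
(* Here [H] is equivalent to [F]: if [a] in [B] divides [p * m] and [p ^ k] divides [m], then
   [p * a] divides [p * m], and [p] cancels. *)
apply: nFH; split=> // A [HA /calUP UA].
pose B := level p k `&` A.
have /GE FB : betaN_sets G (upclosure B).
  apply: HG; split; last exact: calU_upclosure.
  exact: filterS (@sub_upclosure B) (filterI Hk HA).
apply: filterS (filterI FB Fk) => m [[a [ak Aa] apm] [pm _]].
apply: UA Aa _; rewrite -(dvdn_pmul2l (prime_gt0 pp)).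
by apply: level_dvdn ak _ apm => //; rewrite expnS dvdn_mul.
Qed.

(** Strip prime factors from [a] until the quotient [b] divides [F]. For the last prime [p] removed,
    [k] is the valuation of [b]: if [p ^ k.+1] also divided [F], so would [p * b]. *)
Lemma exists_level (F : betaN) (a : nat) : 0 < a ->
  ~ betaN_sets F (multiples a) ->
  exists p k, prime p /\ betaN_sets F (level p k).
Proof.
elim/ltn_ind: a => a IHa a0 nFa.
have a1 : 1 < a.
  rewrite ltn_neqAle a0 andbT; apply/eqP => a1; apply: nFa.
  by apply: filterS filterT => m _; rewrite /multiples /= -a1 dvd1n.
have pp := pdiv_prime a1; set p := pdiv a in pp.
have [b ab] : exists b, a = p * b.
  by have /dvdnP[b ab] := pdiv_dvd a; exists b; rewrite mulnC.
have b0 : 0 < b by move: a0; rewrite ab muln_gt0 => /andP[].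
have [Fb|nFb] := pselect (betaN_sets F (multiples b)); last first.
  by apply: IHa nFb => //; rewrite ab ltn_Pmull ?prime_gt1.
pose k := logn p b.
have bk : level p k b.
  by split; rewrite pfactor_dvdn // ?ltnn.
exists p, k; split=> //; apply: level_multiples.
  by apply: filterS Fb => m; apply: dvdn_trans (pfactor_dvdnn _ _).
move=> FpkS; apply: nFa; apply: filterS (filterI Fb FpkS) => m [bm pm].
by rewrite /multiples /= ab; apply: level_dvdn bk pm bm.
Qed.

Lemma multiples_sub (A : set nat) (a : nat) :
  calU A -> A a -> multiples a `<=` A.
Proof. by move=> /calUP UA Aa m; apply: UA. Qed.

(** [multiples 0] is the singleton of 0. If [H] avoids it, each up-set in [H] has a nonzero element
    [a], hence contains [multiples a], which is in [F]. *)
Lemma immediate_succ_zero (F : betaN) :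
  (forall a, 0 < a -> betaN_sets F (multiples a)) ->
  ~ betaN_sets F (multiples 0) ->
  immediate_succ F (principal 0).
Proof.
move=> Fdvd nF0.
have le0 (H : betaN) : tdvd H (principal 0).
  move=> A [HA /calUP UA]; apply/principal_filterP.
  by have [a Aa] := filter_ex HA; apply: UA Aa (dvdn0 a).
split=> //; first by case=> _ /principal_tdvdE.
case=> H [FH _ nFH nH0].
have [H0|/betaN_setC Hn0] := pselect (betaN_sets H (multiples 0)).
  by apply: nH0; split=> //; apply/principal_tdvdE.
apply: nFH; split=> // A [HA UA].
have [a [Aa a0]] := filter_ex (filterI HA Hn0).
apply: filterS (multiples_sub UA Aa) (Fdvd a _).
by rewrite lt0n; apply/eqP => az; apply: a0; rewrite az /multiples /= dvdn0.
Qed.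

Theorem theorem4p7 :
  (forall F : betaN, ~ MAX F -> exists G : betaN, immediate_succ F G) /\
  (forall F : betaN,
     (exists p n : nat,
        [/\ prime p, n <> 0, tdvd (principal (p ^ n)) F
          & ~ tdvd (principal (p ^ n.+1)) F]) ->
     exists G : betaN, immediate_pred F G).
Proof.
split=> [F nMAX|F [p [[|k] [pp // _ /principal_tdvdE Fk nFk]]]].
  have [[a [a0 nFa]]|Fdvd] :=
    pselect (exists a, 0 < a /\ ~ betaN_sets F (multiples a)).
    have [p [k [pp Fk]]] := exists_level a0 nFa.
    by exists (betaN_map (muln p) F); apply: immediate_succ_mulp pp Fk _.
  exists (principal 0); apply: immediate_succ_zero => [a a0|F0].
    by apply: contrapT => nFa; apply: Fdvd; exists a.
  (* Every nonempty up-set contains 0, so an ultrafilter concentrated at 0 is in [MAX]. *)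
  apply: nMAX => A [UA /eqP/set0P[a Aa]].
  apply: filterS F0; apply: (multiples_sub UA).
  by move/calUP: (UA); apply; [exact: Aa|exact: dvdn0].
have Fl : betaN_sets F (level p k.+1).
  by apply: level_multiples => // FkS; apply/nFk/principal_tdvdE.
have Fp : betaN_sets F (multiples p).
  by apply: filterS Fk => m; apply: dvdn_trans; rewrite expnS dvdn_mulr.
(* Truncated division is harmless: it is exact on [multiples p], a set in [F]. *)
have mulpK m : multiples p m -> p * (m %/ p) = m by rewrite mulnC => /divnK.
exists (betaN_map (divn^~ p) F); apply: (@immediate_succ_mulp _ _ p k pp).
  apply: filterS (filterI Fl Fp) => m [ml /mulpK pm].
  by rewrite /preimage /=; apply/(mulp_level _ _ pp); rewrite pm.
move=> A; split.
  move=> FA; apply: filterS (filterI FA Fp) => m [Am /mulpK pm].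
  by rewrite /preimage /= pm.
move=> FA; have {}FA : betaN_sets F [set m | A (p * (m %/ p))] by [].
by apply: filterS (filterI FA Fp) => m [/= Am /mulpK <-].
Qed.
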